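(* Let $\mathit{ISA}$ be an architecture over a set of architectural registers $\mathit{Arch}$ and let $\mathit{Impl}$ be a microarchitecture with architectural registers $\mathit{Arch}$ and microarchitectural registers $\mu\mathit{Arch}$. Let $\mathit{LM}$ be a leakage monitor, let $\mathit{Atk}$ be an attacker (a combinatorial monitoring circuit for $\mathit{Impl}$), and let $\phi$ be a retirement predicate over $\mathrm{vars}(\mathit{Impl})$. If $\mathit{Impl}$ correctly implements $\mathit{ISA}$ given $\phi$ (written $\mathit{Impl} \vdash_{\phi} \mathit{ISA}$), then $$ \mathit{LM} \succeq_{\mathit{Impl}}^{\mu\mathit{Arch},\phi} \mathit{Atk} \iff \mathit{LM}[\mathit{ISA}] \sqsupseteq \mathit{Atk}[\mathit{Impl}], $$ that is, microarchitectural contract satisfaction holds if and only if $\mathit{Impl}$ satisfies the contract $\mathit{LM}[\mathit{ISA}]$ for attacker $\mathit{Atk}$.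
   Context: **Circuits.** Let $\mathit{Vals}=\mathbb{N}\cup\{\bot\}$, let $\mathit{Regs}$ be a set of registers and $\mathit{Vars}$ a disjoint set of (wire) variables; identifiers are elements of $\mathit{Regs}\cup\mathit{Vars}$. Expressions are $e ::= n \mid i \mid \ominus e \mid e_1\otimes e_2 \mid \mathbf{if}\ e_1\ \mathbf{th}\ e_2\ \mathbf{el}\ e_3 \mid e_1[e_2:e_3]$, with $n\in\mathit{Vals}$, $i$ an identifier, $\ominus,\otimes$ ranging over fixed unary/binary operators on $\mathit{Vals}$, and $e_1[e_2:e_3]$ a bit-selection operator. A circuit $C$ is a triple $C.A : C.W : C.O$ where $C.A$ is a finite set of assignments $r\leftarrow e$ ($r$ a register), $C.W$ is a finite set of wires $v=e$ ($v$ a variable), and $C.O$ is a finite set of identifiers (outputs). $\mathrm{read}(C)$ is the set of registers occurring in a right-hand side of an assignment in $C.A$ or a wire in $C.W$; $\mathrm{write}(C)$ is the set of registers on left-hand sides in $C.A$; $\mathrm{wires}(C)$ is the set of variables on left-hand sides in $C.W$; $\mathrm{vars}(C)=\mathrm{read}(C)\cup\mathrm{write}(C)$. It is assumed that $C.O\subseteq \mathrm{vars}(C)\cup\mathrm{wires}(C)$ (for a monitor, this is understood for its composition with the monitored circuit), that each register/variable is on the left-hand side of at most one assignment/wire, and that wires have no cyclic dependencies. **Semantics.** A valuation is a map $\mu:\mathit{Regs}\to\mathit{Vals}$. $\mathrm{states}(C)$ is the set of valuations over $\mathrm{vars}(C)$ (registers outside $\mathrm{vars}(C)$ have value $\bot$).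 For a set of registers $V$, $\mu\sim_V\mu'$ means $\mu(r)=\mu'(r)$ for all $r\in V$. The value $[\![e]\!]_C(\mu)$ of an expression is defined recursively: registers evaluate to $\mu(r)$, a wire variable $v$ evaluates to the value of $e$ where $(v=e)\in C.W$, operators are applied to the values of their arguments, and $\mathbf{if}\ e_1\ \mathbf{th}\ e_2\ \mathbf{el}\ e_3$ is the value of $e_2$ if the value of $e_1$ is $\neq 0$ and that of $e_3$ otherwise. A predicate $\phi$ is an expression, and $C,\mu\models\phi$ iff $[\![\phi]\!]_C(\mu)\neq 0$. The one-step semantics $[\![C]\!](\mu)$ is the valuation mapping $r$ to $[\![e]\!]_C(\mu)$ if $(r\leftarrow e)\in C.A$ and to $\mu(r)$ if $r\notin\mathrm{write}(C)$. Put $[\![C]\!](\mu,0)=\mu$ and $[\![C]\!](\mu,n+1)=[\![C]\!]([\![C]\!](\mu,n))$. The infinite trace $[\![C]\!]^\infty(\mu)$ is the sequence $\mu_0\cdot\mu_1\cdots$ where $\mu_i$ records the values (register values, and evaluated wire variables) of all outputs in $C.O$ at state $[\![C]\!](\mu,i)$. The filtered trace $[\![C]\!]^\infty|\phi(\mu)$ is the subsequence of those $\mu_i$ for which $C,[\![C]\!](\mu,i)\models\phi$ (the others are dropped). **Architectures and microarchitectures.** An architecture is a circuit $\mathit{ISA}$ with $\mathrm{vars}(\mathit{ISA})=\mathit{ISA}.O=\mathit{Arch}$ and a designated set $\mathrm{init}(\mathit{ISA})\subseteq\mathrm{states}(\mathit{ISA})$ of initial states. A microarchitecture is a circuit $\mathit{Impl}$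 with $\mathrm{vars}(\mathit{Impl})=\mathit{Impl}.O=\mathit{Arch}\cup\mu\mathit{Arch}$, $\mathit{Arch}\cap\mu\mathit{Arch}=\emptyset$, and a designated set $\mathrm{init}(\mathit{Impl})\subseteq\mathrm{states}(\mathit{Impl})$ such that the restriction of every $\mu\in\mathrm{init}(\mathit{Impl})$ to $\mathit{Arch}$ lies in $\mathrm{init}(\mathit{ISA})$. **ISA compliance.** A retirement predicate is a predicate $\phi$ over $\mathrm{vars}(\mathit{Impl})$. $\mathit{Impl}\vdash_\phi\mathit{ISA}$ means that for all $\mu\in\mathrm{init}(\mathit{Impl})$: (1) the sequences $[\![\mathit{Impl}]\!]^\infty|\phi(\mu)$ and $[\![\mathit{ISA}]\!]^\infty(\mu)$ agree element by element on all registers in $\mathit{Arch}$ (in particular the former is infinite); and (2) for all $i\ge 1$, $[\![\mathit{Impl}]\!](\mu,i)\sim_{\mathit{Arch}}[\![\mathit{Impl}]\!](\mu,i-1)$ whenever $[\![\mathit{Impl}]\!](\mu,i)\not\models\phi$. **Monitors.** A circuit $M$ is a monitoring circuit for $C$ if $\mathrm{write}(C)\cap\mathrm{write}(M)=\emptyset$, $\mathrm{wires}(C)\cap\mathrm{wires}(M)=\emptyset$, and $\mathrm{vars}(C)\cap\mathrm{write}(M)=\emptyset$. It is combinatorial if $\mathrm{read}(M)\subseteq\mathrm{vars}(C)$. The composition is $M[C]=(C.A\cup M.A):(C.W\cup M.W):M.O$. A leakage monitor $\mathit{LM}$ is a combinatorial monitoring circuit for $\mathit{ISA}$ that is also a monitoring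 circuit for $\mathit{Impl}$, and which discloses parts of the architectural state only: the wire variables occurring in $\mathit{LM}$ (in right-hand sides or outputs) are all in $\mathrm{wires}(\mathit{LM})$. An attacker $\mathit{Atk}$ is a combinatorial monitoring circuit for $\mathit{Impl}$. **Contract satisfaction.** $\mathit{LM}[\mathit{ISA}]\sqsupseteq\mathit{Atk}[\mathit{Impl}]$ means: for all $\mu,\mu'\in\mathrm{init}(\mathit{Impl})$ with $\mu\sim_{\mu\mathit{Arch}}\mu'$, if $[\![\mathit{LM}[\mathit{ISA}]]\!]^\infty(\mu)=[\![\mathit{LM}[\mathit{ISA}]]\!]^\infty(\mu')$ then $[\![\mathit{Atk}[\mathit{Impl}]]\!]^\infty(\mu)=[\![\mathit{Atk}[\mathit{Impl}]]\!]^\infty(\mu')$. **Leakage ordering.** For monitors $M,M'$ of a circuit $C$, a set $V\subseteq\mathrm{vars}(C)$ and a predicate $\phi$ over $C$, $M\succeq_C^{V,\phi}M'$ means: for all $\mu,\mu'\in\mathrm{init}(C)$ with $\mu\sim_V\mu'$, if $[\![M[C]]\!]^\infty|\phi(\mu)=[\![M[C]]\!]^\infty|\phi(\mu')$ then $[\![M'[C]]\!]^\infty(\mu)=[\![M'[C]]\!]^\infty(\mu')$. Microarchitectural contract satisfaction is $\mathit{LM}\succeq_{\mathit{Impl}}^{\mu\mathit{Arch},\phi}\mathit{Atk}$.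
   Formalization: A leakage monitor's output registers are required to be architectural registers; if it may output a register it writes itself (e.g. r ← 5), the equivalence can fail, since the first retirement may or may not occur at step 0. *)

(* Defs.v *)
From HB Require Import structures.
From mathcomp Require Import all_boot.
From mathcomp Require Import finmap.

Set Implicit Arguments.
Unset Strict Implicit.
Unset Printing Implicit Defensive.

Local Open Scope fmap_scope.
Local Open Scope fset_scope.

(* Vals = N + {bot}: [Some n] is the number n and [None] is bot. *)
Definition val := option nat.
Definition bot : val := None.

(* The fixed operators: symbols with their interpretation on [val]. The third
   field interprets the bit selection e1[e2:e3]. *)
Record operators := Operators {
  unop : Type;
  binop : Type;
  unop_sem : unop -> val -> val;
  binop_sem : binop -> val -> val -> val;
  bitsel_sem : val -> val -> val -> val }.

Section Circuits.

Variables (Regs Vars : choiceType) (S : operators).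

(* Identifiers: [inl r] is a register and [inr v] a wire variable. *)
Definition ident := (Regs + Vars)%type.

Inductive expr :=
  | Const of val
  | Ident of ident
  | Unop of unop S & expr
  | Binop of binop S & expr & expr
  | Ite of expr & expr & expr
  | Bitsel of expr & expr & expr.

Fixpoint idents (e : expr) : {fset ident} :=
  match e with
  | Const _ => fset0
  | Ident i => [fset i]
  | Unop _ e1 => idents e1
  | Binop _ e1 e2 => idents e1 `|` idents e2
  | Ite e1 e2 e3 => idents e1 `|` idents e2 `|` idents e3
  | Bitsel e1 e2 e3 => idents e1 `|` idents e2 `|` idents e3
  end.

(* Finite maps: each register (resp. wire variable) is the left-hand side of
   at most one assignment (resp. wire). *)
Record circuit := Circuit {
  assigns : {fmap Regs -> expr};
  wire_defs : {fmap Vars -> expr};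
  outputs : {fset ident} }.

Implicit Types (C M : circuit) (e phi : expr) (r : Regs) (v : Vars).

Definition map_idents (K : choiceType) (f : {fmap K -> expr}) : {fset ident} :=
  \bigcup_(k <- domf f) (if f.[? k] is Some e then idents e else fset0).

Definition rhs_idents C : {fset ident} :=
  map_idents (assigns C) `|` map_idents (wire_defs C).

Definition read C : {fset Regs} :=
  \bigcup_(i <- rhs_idents C) (if i is inl r then [fset r] else fset0).
Definition write C : {fset Regs} := domf (assigns C).
Definition wires C : {fset Vars} := domf (wire_defs C).
Definition vars C : {fset Regs} := read C `|` write C.

Definition wire_dep C : rel Vars := fun v u =>
  if (wire_defs C).[? v] is Some e then inr u \in idents e else false.

Definition acyclic C : Prop :=
  forall p : seq Vars, cycle (wire_dep C) p -> p = [::].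

(* The standing assumptions on circuits. The second one says that every wire
   variable that occurs has a defining wire, without which its value is not
   specified by the recursive semantics. *)
Definition wf_circuit C : Prop :=
  [/\ acyclic C,
      forall v, inr v \in rhs_idents C -> v \in wires C &
      forall i, i \in outputs C ->
        match i with inl r => r \in vars C | inr v => v \in wires C end].

Definition valuation := Regs -> val.
Implicit Types mu : valuation.

Definition truthy (x : val) : bool := x != Some 0.

(* The value of an expression from the values [mu] of the registers and the
   values [nu] of the wire variables. *)
Fixpoint eval_with mu (nu : Vars -> val) (e : expr) : val :=
  match e with
  | Const x => x
  | Ident (inl r) => mu r
  | Ident (inr v) => nu v
  | Unop o e1 => unop_sem o (eval_with mu nu e1)
  | Binop o e1 e2 => binop_sem o (eval_with mu nu e1) (eval_with mu nu e2)
  | Ite e1 e2 e3 =>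
      if truthy (eval_with mu nu e1) then eval_with mu nu e2
      else eval_with mu nu e3
  | Bitsel e1 e2 e3 =>
      bitsel_sem S (eval_with mu nu e1) (eval_with mu nu e2)
                   (eval_with mu nu e3)
  end.

Definition wire_step C mu (nu : Vars -> val) : Vars -> val := fun v =>
  if (wire_defs C).[? v] is Some e then eval_with mu nu e else bot.

(* Unfolding the wire definitions as many times as there are wires reaches a
   fixed point when they are acyclic; see [eval_wire]. *)
Definition wire_value C mu : Vars -> val :=
  iter #|` wires C| (wire_step C mu) (fun=> bot).

Definition eval C mu (e : expr) : val := eval_with mu (wire_value C mu) e.

Lemma eval_with_eq mu (nu nu' : Vars -> val) e :
  (forall v, inr v \in idents e -> nu v = nu' v) ->
  eval_with mu nu e = eval_with mu nu' e.
Proof.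
elim: e => [x|[r|v]|o e1 IH1|o e1 IH1 e2 IH2|e1 IH1 e2 IH2 e3 IH3
           |e1 IH1 e2 IH2 e3 IH3] //= eq_nu.
- by apply: eq_nu; rewrite inE.
- by rewrite IH1.
- by rewrite IH1 ?IH2 // => v e_v; apply: eq_nu; rewrite inE e_v ?orbT.
- by rewrite IH1 ?IH2 ?IH3 // => v e_v; apply: eq_nu; rewrite !inE e_v ?orbT.
- by rewrite IH1 ?IH2 ?IH3 // => v e_v; apply: eq_nu; rewrite !inE e_v ?orbT.
Qed.

Lemma acyclic_uniq C v p :
  acyclic C -> path (wire_dep C) v p -> uniq (v :: p).
Proof.
move=> acC; elim: p v => [//|u p IHp] v path_p.
rewrite cons_uniq; apply/andP; split; last first.
  by apply: IHp; case/andP: path_p.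
apply/negP => v_p; case/splitPr: v_p path_p => p1 p2.
rewrite -cat_rcons cat_path => /andP[cyc _].
by have := acC (v :: p1) cyc.
Qed.

Lemma eval_wire C mu v e : acyclic C -> (wire_defs C).[? v] = Some e ->
  eval C mu (Ident (inr v)) = eval C mu e.
Proof.
move=> acC def_v; rewrite /eval /= /wire_value.
pose W n := iter n (wire_step C mu) (fun=> bot).
have Wbot n u : u \notin wires C -> W n u = bot.
  by move=> u_C; case: n => //= n; rewrite /wire_step not_fnd.
have stable n u : u \in wires C ->
    (forall p, path (wire_dep C) u p -> all [in wires C] p -> size p <> n) ->
    forall m, n <= m -> W m u = W n u.
  elim: n u => [|n IHn] u u_C nopath m; first by case: (nopath [::]).
  case: m => // m le_nm; rewrite /= /wire_step.
  case def_u: (_.[? u]) => [e'|] //; apply: eval_with_eq => t e't.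
  have [t_C|] := boolP (t \in wires C); last by move=> t_C; rewrite !Wbot.
  apply: IHn => // p path_p p_C sz_p.
  case: (nopath (t :: p)) => /=; last by rewrite sz_p.
    by rewrite path_p andbT /wire_dep def_u.
  by rewrite t_C.
have v_C : v \in wires C by rewrite /wires -fndSome def_v.
rewrite -/(W _) -(stable _ v v_C _ #|` wires C|.+1) //=.
  by rewrite /wire_step def_v.
move=> p path_p p_C sz_p.
suff sub : {subset v :: p <= enum_fset (wires C)}.
  by have := uniq_leq_size (acyclic_uniq acC path_p) sub; rewrite /= sz_p ltnn.
by move=> u; rewrite inE => /predU1P[->|/(allP p_C)].
Qed.

Definition sat C mu phi : bool := truthy (eval C mu phi).

Definition step C mu : valuation := fun r =>
  if (assigns C).[? r] is Some e then eval C mu e else mu r.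

Definition run C mu (n : nat) : valuation := iter n (step C) mu.

(* An observation records the value of every output. *)
Definition observation := {fmap ident -> val}.

Definition observe C mu : observation :=
  [fmap i : outputs C => eval C mu (Ident (fsval i))].

Definition trace C mu : nat -> observation := fun n => observe C (run C mu n).

(* [i] is the position in the trace of the element number [n] (from 0) of the
   filtered trace. *)
Definition nth_sat C phi mu (n i : nat) : Prop :=
  sat C (run C mu i) phi /\
  count (fun j => sat C (run C mu j) phi) (iota 0 i) = n.

(* The filtered trace may be finite or infinite: it is represented by its
   graph, [filtered C phi mu n o] meaning that it has an element number [n]
   and that this element is [o]. *)
Definition filtered C phi mu (n : nat) (o : observation) : Prop :=
  exists2 i, nth_sat C phi mu n i & o = trace C mu i.

Definition same_trace C mu mu' : Prop := trace C mu =1 trace C mu'.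

Definition same_filtered C phi mu mu' : Prop :=
  forall n o, filtered C phi mu n o <-> filtered C phi mu' n o.

Definition agree (V : {fset Regs}) mu mu' : Prop :=
  forall r, r \in V -> mu r = mu' r.

Definition states C mu : Prop := forall r, r \notin vars C -> mu r = bot.

Definition restrict (V : {fset Regs}) mu : valuation :=
  fun r => if r \in V then mu r else bot.

(* A circuit with its designated initial states. *)
Record machine := Machine {
  circ :> circuit;
  init : valuation -> Prop }.

Implicit Types ISA Impl : machine.

Definition architecture (Arch : {fset Regs}) ISA : Prop :=
  [/\ wf_circuit ISA,
      vars ISA = Arch,
      outputs ISA = [fset inl r | r in Arch] &
      forall mu, init ISA mu -> states ISA mu].

Definition microarchitecture (Arch muArch : {fset Regs}) ISA Impl : Prop :=
  [/\ wf_circuit Impl,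
      vars Impl = Arch `|` muArch /\
      outputs Impl = [fset inl r | r in Arch `|` muArch],
      [disjoint Arch & muArch],
      forall mu, init Impl mu -> states Impl mu &
      forall mu, init Impl mu -> init ISA (restrict Arch mu)].

Definition predicate_over (V : {fset Regs}) phi : Prop :=
  forall i, i \in idents phi -> if i is inl r then r \in V else false.

Definition compliant (Arch : {fset Regs}) ISA Impl phi : Prop :=
  forall mu, init Impl mu ->
    (forall n, exists2 o, filtered Impl phi mu n o &
       forall r, r \in Arch -> o.[? inl r] = (trace ISA mu n).[? inl r]) /\
    (forall i, 0 < i -> ~~ sat Impl (run Impl mu i) phi ->
       agree Arch (run Impl mu i) (run Impl mu i.-1)).

(* [f + g] is the union of finite maps with disjoint domains, as they are here
   whenever M is a monitoring circuit for C. *)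
Definition compose M C : circuit :=
  Circuit (assigns C + assigns M) (wire_defs C + wire_defs M) (outputs M).

Definition monitoring M C : Prop :=
  [/\ [disjoint write C & write M],
      [disjoint wires C & wires M] &
      [disjoint vars C & write M]].

Definition combinatorial M C : Prop := read M `<=` vars C.

(* The standing assumptions on a monitor are those on its compositions. The
   last condition says that only parts of the architectural state are
   disclosed: the outputs are architectural registers or wires of the monitor,
   which are defined from architectural registers only. *)
Definition leakage_monitor ISA Impl LM : Prop :=
  [/\ monitoring LM ISA /\ wf_circuit (compose LM ISA),
      combinatorial LM ISA,
      monitoring LM Impl /\ wf_circuit (compose LM Impl),
      forall v, inr v \in rhs_idents LM -> v \in wires LM &
      forall i, i \in outputs LM ->
        match i with inl r => r \in vars ISA | inr v => v \in wires LM end].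

Definition attacker Impl Atk : Prop :=
  [/\ monitoring Atk Impl,
      wf_circuit (compose Atk Impl) &
      combinatorial Atk Impl].

Definition contract_satisfaction (muArch : {fset Regs}) ISA Impl LM Atk : Prop :=
  forall mu mu', init Impl mu -> init Impl mu' -> agree muArch mu mu' ->
    same_trace (compose LM ISA) mu mu' ->
    same_trace (compose Atk Impl) mu mu'.

Definition leakage_order (C : machine) (V : {fset Regs}) phi M M' : Prop :=
  forall mu mu', init C mu -> init C mu' -> agree V mu mu' ->
    same_filtered (compose M C) phi mu mu' ->
    same_trace (compose M' C) mu mu'.

End Circuits.

(* Main.v *)
Require Import Defs.
From mathcomp Require Import all_boot.
From mathcomp Require Import finmap.

(** A leakage monitor reads and outputs architectural registers and its own
    wires only, so its observation is the same function of the architectural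
    registers whether it is composed with ISA or with Impl. By compliance, the
    architectural registers at the n-th retirement of Impl are those of ISA
    after n steps. Hence the filtered trace of LM[Impl] is the trace of LM[ISA],
    and the two contract notions have equivalent hypotheses. *)

Set Implicit Arguments.
Unset Strict Implicit.
Unset Printing Implicit Defensive.

Local Open Scope fmap_scope.
Local Open Scope fset_scope.

Section Monitors.

Variables (Regs Vars : choiceType) (S : operators).

Implicit Types (C M : circuit Regs Vars S) (e phi : expr Regs Vars S).
Implicit Types (mu : valuation Regs) (V : {fset Regs}) (W : {fset Vars}).

Definition idents_within V W (e : expr Regs Vars S) : Prop :=
  forall i, i \in idents e ->
    match i with inl r => r \in V | inr v => v \in W end.

Lemma eval_with_agree V W mu mu' (nu nu' : Vars -> Defs.val) e :
  idents_within V W e -> agree V mu mu' ->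
  (forall v, v \in W -> nu v = nu' v) ->
  eval_with mu nu e = eval_with mu' nu' e.
Proof.
move=> e_VW eq_mu eq_nu; elim: e e_VW => [x|[r|v]|o e1 IH1|o e1 IH1 e2 IH2
  |e1 IH1 e2 IH2 e3 IH3|e1 IH1 e2 IH2 e3 IH3] //= e_VW.
- by apply: eq_mu; apply: (e_VW (inl r)); rewrite inE.
- by apply: eq_nu; apply: (e_VW (inr v)); rewrite inE.
- by rewrite IH1.
- by rewrite IH1 ?IH2 // => i e_i; apply: e_VW; rewrite inE e_i ?orbT.
- by rewrite IH1 ?IH2 ?IH3 // => i e_i; apply: e_VW; rewrite !inE e_i ?orbT.
- by rewrite IH1 ?IH2 ?IH3 // => i e_i; apply: e_VW; rewrite !inE e_i ?orbT.
Qed.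

(** By [eval_wire], [wire_value] is a fixed point of [wire_step] for acyclic wires, so unfolding
    further changes nothing. *)
Lemma wire_value_iter C mu n v : acyclic C ->
  iter (n + #|` wires C|) (wire_step C mu) (fun=> bot) v = wire_value C mu v.
Proof.
move=> acC; elim: n v => [//|n IHn] v; rewrite addSn /= /wire_step.
case def_v: (_.[? v]) => [e|].
  rewrite (@eval_with_eq _ _ _ _ _ (wire_value C mu)) => [|u _]; last exact: IHn.
  by rewrite -/(eval C mu e) -(eval_wire mu acC def_v).
(* An undefined wire is [bot] after any number of unfoldings, zero included. *)
by rewrite /wire_value; case: #|` _| => //= k; rewrite /wire_step def_v.
Qed.

(* The number of unfoldings in [wire_value] depends on the circuit; by
   acyclicity both circuits may be unfolded the same number of times. *)
Lemma wire_value_agree C C' V W mu mu' :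
  acyclic C -> acyclic C' ->
  (forall v, v \in W -> (wire_defs C).[? v] = (wire_defs C').[? v]) ->
  (forall v e, v \in W -> (wire_defs C).[? v] = Some e ->
     idents_within V W e) ->
  agree V mu mu' ->
  forall v, v \in W -> wire_value C mu v = wire_value C' mu' v.
Proof.
move=> acC acC' eq_defs defs_VW eq_mu v v_W.
rewrite -(wire_value_iter mu #|` wires C'| v acC).
rewrite -(wire_value_iter mu' #|` wires C| v acC').
rewrite [X in _ = iter X _ _ _]addnC.
elim: (_ + _)%N v v_W => [//|n IHn] v v_W /=; rewrite /wire_step -eq_defs //.
case def_v: (_.[? v]) => [e|//].
exact: eval_with_agree (defs_VW v e v_W def_v) eq_mu IHn.
Qed.

Lemma map_idents_fnd (K : choiceType) (f : {fmap K -> expr Regs Vars S}) k e i :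
  f.[? k] = Some e -> i \in idents e -> i \in map_idents f.
Proof.
move=> def_k e_i; apply/bigfcupP; exists k; last by rewrite def_k.
by rewrite andbT -fndSome def_k.
Qed.

Lemma rhs_idents_read C r : inl r \in rhs_idents C -> r \in read C.
Proof.
by move=> C_r; apply/bigfcupP; exists (inl r); rewrite ?C_r ?inE.
Qed.

Lemma rhs_idents_within C e :
  (forall v, inr v \in rhs_idents C -> v \in wires C) ->
  {subset idents e <= rhs_idents C} -> idents_within (read C) (wires C) e.
Proof. by move=> C_W e_C [r|v] /e_C; [apply: rhs_idents_read | apply: C_W]. Qed.

Lemma wire_idents_within C v e :
  (forall u, inr u \in rhs_idents C -> u \in wires C) ->
  (wire_defs C).[? v] = Some e -> idents_within (read C) (wires C) e.
Proof.
move=> C_W def_v; apply: rhs_idents_within => // i e_i.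
by rewrite inE (map_idents_fnd def_v e_i) orbT.
Qed.

Lemma assign_idents_within C r e :
  (forall u, inr u \in rhs_idents C -> u \in wires C) ->
  (assigns C).[? r] = Some e -> idents_within (read C) (wires C) e.
Proof.
move=> C_W def_r; apply: rhs_idents_within => // i e_i.
by rewrite inE (map_idents_fnd def_r e_i).
Qed.

Lemma agree_sub V V' mu mu' : V' `<=` V -> agree V mu mu' -> agree V' mu mu'.
Proof. by move=> /fsubsetP sub eq_mu r /sub/eq_mu. Qed.

(** The right-hand sides of [C] mention only registers and wires of [C], and [M] neither writes the
    former nor redefines the latter. Agreement on [vars C] is thus preserved by each step. *)
Lemma run_compose M C mu n :
  wf_circuit C -> acyclic (compose M C) -> monitoring M C ->
  agree (vars C) (run (compose M C) mu n) (run C mu n).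
Proof.
move=> [acC C_W _] acMC [_ disW disV]; elim: n => [//|n IHn] r C_r.
have eq_read := agree_sub (fsubsetUl (read C) (write C)) IHn.
rewrite /= /step /= fnd_cat (negPf (fdisjointP disV _ C_r)).
case def_r: (_.[? r]) => [e|]; last exact: IHn.
apply: (eval_with_agree (assign_idents_within C_W def_r) eq_read).
have eq_defs v : v \in wires C ->
    (wire_defs (compose M C)).[? v] = (wire_defs C).[? v].
  by move=> C_v; rewrite fnd_cat (negPf (fdisjointP disW _ C_v)).
apply: wire_value_agree eq_read => // v e' C_v.
by rewrite eq_defs //; apply: wire_idents_within.
Qed.

(** Without wire variables in [e], the circuit has no influence on its value, so [C] and [C'] may be
    unrelated. *)
Lemma eval_agree C C' V mu mu' e :
  idents_within V fset0 e -> agree V mu mu' -> eval C mu e = eval C' mu' e.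
Proof. by move=> e_V eq_mu; apply: eval_with_agree e_V eq_mu _. Qed.

(** The wires of [M] refer only to each other and to registers in [V], and they keep their
    definitions in both compositions. *)
Lemma observe_compose M C C' V mu mu' :
  acyclic (compose M C) -> acyclic (compose M C') ->
  (forall v, inr v \in rhs_idents M -> v \in wires M) ->
  read M `<=` V ->
  (forall i, i \in outputs M ->
     match i with inl r => r \in V | inr v => v \in wires M end) ->
  agree V mu mu' ->
  observe (compose M C) mu = observe (compose M C') mu'.
Proof.
move=> acC acC' M_W M_V M_O eq_mu; rewrite /observe.
have defM D v : v \in wires M ->
    (wire_defs (compose M D)).[? v] = (wire_defs M).[? v].
  by move=> M_v; rewrite /= fnd_cat M_v.
congr FinMap; apply/ffunP => -[i O_i]; rewrite !ffunE /=.
have := M_O i O_i; case: i {O_i} => [r|v]; first exact: eq_mu.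
move=> M_v; apply: (wire_value_agree acC acC' _ _ (agree_sub M_V eq_mu) M_v).
  by move=> u M_u; rewrite !defM.
by move=> u e M_u; rewrite defM //; apply: wire_idents_within.
Qed.

(** If [i < j], the count below [j] includes the hit at [i] itself, so it exceeds the count below
    [i]. *)
Lemma nth_sat_inj C phi mu n i j :
  nth_sat C phi mu n i -> nth_sat C phi mu n j -> i = j.
Proof.
wlog lt_ij : i j / i < j => [wlog_ij|].
  move=> Hi Hj; case: (ltngtP i j) => // ij; first exact: wlog_ij.
  by apply/esym; apply: wlog_ij.
move=> [sat_i <-] [_] /eqP.
have -> : iota 0 j = iota 0 i ++ i :: iota i.+1 (j - i.+1).
  by rewrite -{1}(subnKC lt_ij) addSnnS iotaD.
by rewrite count_cat /= sat_i add1n -[X in _ == X]addn0 eqn_add2l.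
Qed.

Lemma nth_sat_agree C C' V phi mu :
  idents_within V fset0 phi ->
  (forall n, agree V (run C mu n) (run C' mu n)) ->
  forall n i, nth_sat C phi mu n i <-> nth_sat C' phi mu n i.
Proof.
move=> phi_V eq_run n i.
have eq_sat j : sat C (run C mu j) phi = sat C' (run C' mu j) phi.
  by rewrite /sat (eval_agree C C' phi_V (eq_run j)).
by rewrite /nth_sat eq_sat (eq_count eq_sat).
Qed.

Lemma filtered_nth_sat C phi mu n i o :
  nth_sat C phi mu n i -> filtered C phi mu n o <-> o = trace C mu i.
Proof.
move=> sat_i; split=> [[j sat_j ->]|->]; last by exists i.
by rewrite (nth_sat_inj sat_i sat_j).
Qed.

Lemma trace_register C mu n r :
  inl r \in outputs C -> (trace C mu n).[? inl r] = Some (run C mu n r).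
Proof.
by move=> O_r; rewrite (in_fnd O_r) ffunE.
Qed.

Lemma filtered_leakage (Arch muArch : {fset Regs})
    (ISA Impl : machine Regs Vars S) (LM : circuit Regs Vars S) phi mu n o :
  architecture Arch ISA -> microarchitecture Arch muArch ISA Impl ->
  leakage_monitor ISA Impl LM -> predicate_over (vars Impl) phi ->
  compliant Arch ISA Impl phi -> init Impl mu ->
  filtered (compose LM Impl) phi mu n o <-> o = trace (compose LM ISA) mu n.
Proof.
move=> [wfA varsA outA _] [wfI [varsI outI] _ _ _].
move=> [[monA [acA _ _]] combA [monI [acI _ _]] LM_W LM_O] phi_I comp init_mu.
(* Here [i] is the position of retirement number [n] in the run of [Impl] alone. *)
have [/(_ n)[_ [i sat_i ->] eq_arch] _] := comp mu init_mu.
have phi_V : idents_within (vars Impl) fset0 phi by move=> [r|v] /phi_I.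
have eq_run := run_compose mu _ wfI acI monI.
(* The monitor leaves the registers read by [phi] unchanged, so the same [i] is the position of that
   retirement in [LM[Impl]]. *)
have sat_LM := (nth_sat_agree phi_V eq_run n i).2 sat_i.
suff -> : trace (compose LM ISA) mu n = trace (compose LM Impl) mu i.
  exact: filtered_nth_sat sat_LM.
apply: (observe_compose (V := Arch)); rewrite -?varsA // => r A_r.
have A_r' : r \in Arch by rewrite -varsA.
have I_r : r \in Arch `|` muArch by rewrite inE A_r'.
(* Both monitors are stripped from the runs. Compliance compares lookups in traces, so the register
   values are then put under [Some] as outputs. *)
rewrite (run_compose mu n wfA acA monA A_r) eq_run ?varsI //.
apply/esym/Some_inj; rewrite -!trace_register ?eq_arch //.
  by rewrite outA in_imfset.
by rewrite outI in_imfset.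
Qed.

End Monitors.

Theorem theorem1 (Regs Vars : choiceType) (S : operators)
    (Arch muArch : {fset Regs}) (ISA Impl : machine Regs Vars S)
    (LM Atk : circuit Regs Vars S) (phi : expr Regs Vars S) :
  architecture Arch ISA ->
  microarchitecture Arch muArch ISA Impl ->
  leakage_monitor ISA Impl LM ->
  attacker Impl Atk ->
  predicate_over (vars Impl) phi ->
  compliant Arch ISA Impl phi ->
  (leakage_order Impl muArch phi LM Atk <->
   contract_satisfaction muArch ISA Impl LM Atk).
Proof.
move=> archA archI leakLM _ phi_I comp.
have filtE mu n o (mu_init : init Impl mu) :=
  filtered_leakage n o archA archI leakLM phi_I comp mu_init.
have same mu mu' : init Impl mu -> init Impl mu' ->
    same_filtered (compose LM Impl) phi mu mu' <->
    same_trace (compose LM ISA) mu mu'.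
  move=> mu_init mu'_init; split=> [eq_filt n|eq_tr n o].
    (* Element [n] of the contract trace of [mu] is element [n] of its filtered trace, hence of that
       of [mu']. *)
    by apply/(filtE mu' n _ mu'_init)/eq_filt/filtE.
  by rewrite !filtE // eq_tr.
split=> sec mu mu' mu_init mu'_init eq_mu eq_tr;
  by apply: sec => //; apply/same.
Qed.
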